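(* Let $G$ be a graph. Then $G$ satisfies the matching square condition (MSC) if and only if $G$ is unmixed and $G$ is a domain.
   Context: Graphs are finite, simple, undirected, with vertex set $\{1,\dots,n\}$, $n\ge 1$. $\mathbb{N}$ denotes the nonnegative integers. For $k\in\mathbb{N}$, a $k$-cover of $G$ is a nonzero vector $\mathbf{a}=(a_1,\dots,a_n)\in\mathbb{N}^n$ such that $a_i+a_j\ge k$ for every edge $\{i,j\}$ of $G$. A $k$-cover is basic if it cannot be written as the (vertex-wise) sum of a $k$-cover and a $0$-cover (covers are nonzero by definition). $G$ is unmixed if all its basic $1$-covers have the same number of ones (entries equal to $1$). $G$ is a domain if for all $s,t\in\mathbb{N}$, not both zero, the sum of any $s$ basic $1$-covers (repetitions allowed) and any $t$ basic $2$-covers (repetitions allowed) of $G$ is a basic $(s+2t)$-cover of $G$. $G$ satisfies MSC if the graph $G^{red}$ obtained by deleting all the isolated vertices of $G$ is non-empty and admits a perfect matching such that for each edge $\{i,j\}$ of the matching, and for all edges $\{i,i'\}$ and $\{j,j'\}$ of $G$, $\{i',j'\}$ is also an edge of $G$ (in particular $i'\neq j'$). *)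

(* Defs.v *)
From mathcomp Require Import all_boot all_algebra.

Set Implicit Arguments.
Unset Strict Implicit.
Unset Printing Implicit Defensive.

Record graph (n : nat) := Graph {
  edge :> rel 'I_n;
  edge_sym : symmetric edge;
  edge_irr : irreflexive edge }.

(* Vectors of N^n are finite functions: 0, + and \sum below are those of the
   pointwise additive monoid {ffun 'I_n -> nat}. *)

Definition kcover (n : nat) (G : graph n) (k : nat)
    (a : {ffun 'I_n -> nat}) : Prop :=
  a <> 0%R /\ forall i j : 'I_n, G i j -> k <= a i + a j.

Definition basic_cover (n : nat) (G : graph n) (k : nat)
    (a : {ffun 'I_n -> nat}) : Prop :=
  kcover G k a /\
  ~ exists b c : {ffun 'I_n -> nat},
      [/\ kcover G k b, kcover G 0 c & a = (b + c)%R].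

Definition unmixed (n : nat) (G : graph n) : Prop :=
  forall a b : {ffun 'I_n -> nat},
    basic_cover G 1 a -> basic_cover G 1 b ->
    #|[set i | a i == 1]| = #|[set i | b i == 1]|.

Definition graph_domain (n : nat) (G : graph n) : Prop :=
  forall s t : nat, ~ (s = 0 /\ t = 0) ->
  forall (a : 'I_s -> {ffun 'I_n -> nat}) (b : 'I_t -> {ffun 'I_n -> nat}),
    (forall p, basic_cover G 1 (a p)) ->
    (forall q, basic_cover G 2 (b q)) ->
    basic_cover G (s + 2 * t) (\sum_(p < s) a p + \sum_(q < t) b q)%R.

Definition edge_set (n : nat) (G : graph n) : {set {set 'I_n}} :=
  [set [set i; j] | i in 'I_n, j in 'I_n & G i j].

(* Vertex set of G^red; G and G^red have the same edges. *)
Definition red_vertices (n : nat) (G : graph n) : {set 'I_n} :=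
  [set i | [exists j, G i j]].

Definition red_perfect_matching (n : nat) (G : graph n)
    (M : {set {set 'I_n}}) : Prop :=
  M \subset edge_set G /\ partition M (red_vertices G).

Definition MSC (n : nat) (G : graph n) : Prop :=
  red_vertices G != set0 /\
  exists M : {set {set 'I_n}},
    red_perfect_matching G M /\
    forall i j : 'I_n, [set i; j] \in M ->
    forall i' j' : 'I_n, G i i' -> G j j' -> G i' j'.

(* Main.v *)
Require Import Defs.
From mathcomp Require Import all_boot all_algebra.
From mathcomp Require Import zify.

(** Call an edge {i, j} square when every neighbour of i is adjacent to every
    neighbour of j; MSC asks for a perfect matching of square edges on the
    non-isolated vertices.  Everything rests on the description of basic
    k-covers, for k > 0 and G with an edge, as the vectors covering all edges
    in which each positive vertex lies on a tight edge, one where the two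
    entries add up to k ([basic_coverP]): a positive vertex without tight edge
    could be lowered by one.

    Square edges are tight for every basic k-cover ([square_edge_tight]).
    Hence, if each non-isolated vertex is on a square edge, tightness survives
    sums and G is a domain; and if the square edges contain a perfect matching,
    the ones of a basic 1-cover form a transversal of it, so that their number
    is that of the matched edges.

    Conversely, let G be a domain.  If i is a non-isolated vertex and no edge
    at i is square, then for each neighbour j of i there are non-adjacent (maybe equal) i' ~ i and
    j' ~ j.  The 2-cover vanishing on i' and j' and equal to 2 elsewhere
    dominates a basic 2-cover in which i and j both have value 2, so that
    {i, j} is not tight.  In the sum of these covers over all j no edge at i is
    tight although i is positive, so the sum is not basic
    ([domain_square_matchable]).

    It remains to extract a perfect matching.  The square edges at i lead
    exactly to the twins of any one of its square partners j, that is, to the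
    vertices with the same neighbourhood as j ([square_edge_twins]).  So the
    square edges form disjoint complete bipartite graphs between twin classes,
    and a perfect matching exists as soon as paired classes have equal
    cardinality.  Unmixedness gives this: some basic 1-cover is 0 on the class
    of i and 1 on the class of j, and remains a basic 1-cover when these values
    are exchanged ([twins_seed], [swap_coverP]). *)

Set Implicit Arguments.
Unset Strict Implicit.
Unset Printing Implicit Defensive.

(** * Basic covers and tight edges *)

Lemma ffun_addE n (a b : {ffun 'I_n -> nat}) i : (a + b)%R i = a i + b i.
Proof. by rewrite ffunE. Qed.

Lemma ffun_nat_neq0 n (a : {ffun 'I_n -> nat}) i : 0 < a i -> a <> 0%R.
Proof. by move=> + a0; rewrite a0 ffunE. Qed.

Lemma ffun_nat_neq0P n (a : {ffun 'I_n -> nat}) : a <> 0%R -> exists i, 0 < a i.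
Proof.
move=> a0; apply/existsP; apply: contra_notT a0 => /existsPn a0.
by apply/ffunP => i; rewrite ffunE; apply/eqP; rewrite -leqn0 leqNgt a0.
Qed.

Definition unit_vec n (i : 'I_n) : {ffun 'I_n -> nat} :=
  [ffun v => nat_of_bool (v == i)].

Lemma unit_vec_neq0 n (i : 'I_n) : unit_vec i <> 0%R.
Proof. by apply: (@ffun_nat_neq0 _ _ i); rewrite ffunE eqxx. Qed.

Lemma ffun_decr n (a : {ffun 'I_n -> nat}) i : 0 < a i ->
  exists b : {ffun 'I_n -> nat}, a = (b + unit_vec i)%R.
Proof.
move=> ai; exists [ffun v => a v - (v == i)].
apply/ffunP => v; rewrite ffun_addE !ffunE subnK //.
by case: eqP => [->|].
Qed.

Definition covers n (G : graph n) k (a : {ffun 'I_n -> nat}) :=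
  forall i j, G i j -> k <= a i + a j.

Lemma covers_neq0 n (G : graph n) k (a : {ffun 'I_n -> nat}) x y :
  0 < k -> G x y -> covers G k a -> a <> 0%R.
Proof.
move=> k0 xy /(_ _ _ xy); case: (posnP (a x)) => [->|/ffun_nat_neq0 //].
by move/(leq_trans k0)/ffun_nat_neq0.
Qed.

(** Only the edges at i lose from lowering the entry of i, and they have one to
    spare. *)
Lemma covers_decr n (G : graph n) k (b : {ffun 'I_n -> nat}) i :
  covers G k (b + unit_vec i)%R ->
  (forall j, G i j -> (b + unit_vec i)%R i + (b + unit_vec i)%R j <> k) ->
  covers G k b.
Proof.
move=> acov nt; pose a := (b + unit_vec i)%R.
have aE v : a v = b v + (v == i) by rewrite ffun_addE !ffunE.
have key v : G i v -> k <= b i + b v.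
  move=> iv; have := nt v iv; have := acov _ _ iv; rewrite -/a !aE eqxx.
  have [vi|_] := eqVneq v i; last by rewrite /=; lia.
  by rewrite vi edge_irr in iv.
move=> u v uv; have [ui|ui] := eqVneq u i; first by subst u; apply: key.
have [vi|vi] := eqVneq v i.
  by subst v; rewrite addnC; apply: key; rewrite edge_sym.
by have := acov _ _ uv; rewrite -/a !aE (negbTE ui) (negbTE vi) !addn0.
Qed.

(** Being basic becomes a local condition: for a cover that splits off a nonzero
    c, an edge that is tight at a vertex where c is positive would not be
    covered by the rest. *)
Lemma basic_coverP n (G : graph n) k (a : {ffun 'I_n -> nat}) x y :
  0 < k -> G x y ->
  basic_cover G k a <->
  covers G k a /\ (forall i, 0 < a i -> exists2 j, G i j & a i + a j = k).
Proof.
move=> k0 xy; split=> [[[a0 acov] abas]|[acov atight]].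
  split=> // i ai.
  suff /existsP[j /andP[ij /eqP e]] : [exists j, G i j && (a i + a j == k)].
    by exists j.
  apply: contra_notT abas => /existsPn nt.
  have [b ab] := ffun_decr ai.
  have bcov : covers G k b.
    apply: (@covers_decr _ _ _ _ i); rewrite -ab // => j ij.
    by apply/eqP; have := nt j; rewrite ij.
  exists b, (unit_vec i); split=> //; split=> //; last exact: unit_vec_neq0.
  exact: covers_neq0 k0 xy bcov.
split; first by split=> //; exact: covers_neq0 k0 xy acov.
case=> b [c [[_ bcov] [/ffun_nat_neq0P[i ci] _] abc]].
have aE v : a v = b v + c v by rewrite abc ffun_addE.
have /atight[j ij] : 0 < a i by rewrite aE; lia.
by have := bcov _ _ ij; rewrite !aE; lia.
Qed.

(** The source of all the basic covers below: zeros are inherited by smaller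
    covers, and they force the entries of their neighbours up to k. *)
Lemma basic_cover_below n (G : graph n) k (a : {ffun 'I_n -> nat}) x y :
  0 < k -> G x y -> covers G k a ->
  exists2 b, basic_cover G k b & forall i, b i <= a i.
Proof.
move=> k0 xy; have [m] := ubnP (\sum_i a i).
elim: m a => // m IHm a le_a acov.
have [/forallP atight|/forallPn[i]] :=
    boolP [forall i, (0 < a i) ==> [exists j, G i j && (a i + a j == k)]].
  exists a => //; apply/(basic_coverP _ k0 xy); split=> // i ai.
  by have /implyP/(_ ai)/existsP[j /andP[ij /eqP e]] := atight i; exists j.
rewrite negb_imply => /andP[ai /existsPn nt].
have [b ab] := ffun_decr ai.
have aE v : a v = b v + (v == i) by rewrite ab ffun_addE !ffunE.
have [||c cbas cb] := IHm b.
- move: le_a; rewrite ltnS (eq_bigr _ (fun v _ => aE v)) big_split /=.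
  rewrite [X in _ + X](bigD1 i) //= eqxx add1n addnS.
  by apply: leq_trans; rewrite ltnS leq_addr.
- apply: (@covers_decr _ _ _ _ i); rewrite -ab // => j ij.
  by apply/eqP; have := nt j; rewrite ij.
by exists c => // v; apply: leq_trans (cb v) _; rewrite aE leq_addr.
Qed.

(** * Square edges *)

Definition square_edge n (G : graph n) (i j : 'I_n) : Prop :=
  G i j /\ forall i' j', G i i' -> G j j' -> G i' j'.

Definition square_edgeb n (G : graph n) (i j : 'I_n) : bool :=
  G i j && [forall i', forall j', G i i' ==> G j j' ==> G i' j'].

Lemma square_edgeP n (G : graph n) i j :
  reflect (square_edge G i j) (square_edgeb G i j).
Proof.
apply: (iffP andP) => -[ij sq]; split=> //.
  move=> i' j' ii' jj'.
  by have /forallP/(_ j') := forallP sq i'; rewrite ii' jj'.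
by apply/'forall_forallP => i' j'; apply/implyP=> ?; apply/implyP; apply: sq.
Qed.

Lemma square_edge_sym n (G : graph n) i j :
  square_edge G i j -> square_edge G j i.
Proof.
case=> ij sq; split=> [|j' i' jj' ii']; first by rewrite edge_sym.
by rewrite edge_sym; apply: sq.
Qed.

Lemma square_no_triangle n (G : graph n) i j x :
  square_edge G i j -> G x i -> G x j -> False.
Proof.
case=> _ sq; rewrite ![G x _]edge_sym => ix jx.
by have := sq _ _ ix jx; rewrite edge_irr.
Qed.

(** If a i + a j > k, tight edges {i, i'} and {j, j'} would leave too little on
    the edge {i', j'}. *)
Lemma square_edge_tight n (G : graph n) k a i j :
  0 < k -> basic_cover G k a -> square_edge G i j -> a i + a j = k.
Proof.
move=> k0 abas [ij sq].
have [acov atight] := (proj1 (basic_coverP _ k0 ij)) abas.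
apply/eqP; rewrite eqn_leq acov // andbT leqNgt; apply/negP => lt_k.
have [ai|/atight[i' ii' ti]] := posnP (a i).
  have [|j' _] := atight j; first by lia.
  by lia.
have [aj|/atight[j' jj' tj]] := posnP (a j); first by lia.
by have := acov _ _ (sq _ _ ii' jj'); lia.
Qed.

(** Weaker than MSC: the square edges at distinct vertices need not be
    compatible with one perfect matching. *)
Definition square_matchable n (G : graph n) : Prop :=
  forall i v, G i v -> exists j, square_edge G i j.

Lemma tight_basic_cover n (G : graph n) k (a : {ffun 'I_n -> nat}) x y :
  0 < k -> G x y -> square_matchable G -> covers G k a ->
  (forall i j, square_edge G i j -> a i + a j = k) ->
  (forall i, 0 < a i -> exists v, G i v) -> basic_cover G k a.
Proof.
move=> k0 xy sqG acov atight anis; apply/(basic_coverP _ k0 xy); split=> // i.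
by case/anis => v /sqG[j ij]; exists j; [case: ij | apply: atight].
Qed.

(** * From MSC to unmixed and domain *)

(** Tightness of the square edges is additive, and the square edges alone
    witness that the sum is basic. *)
Lemma basic_cover_sum n (G : graph n) x y s t
    (a : 'I_s -> {ffun 'I_n -> nat}) (b : 'I_t -> {ffun 'I_n -> nat}) :
  G x y -> square_matchable G -> ~ (s = 0 /\ t = 0) ->
  (forall p, basic_cover G 1 (a p)) -> (forall q, basic_cover G 2 (b q)) ->
  basic_cover G (s + 2 * t) (\sum_(p < s) a p + \sum_(q < t) b q)%R.
Proof.
move=> xy sqG st abas bbas; set c := (_ + _)%R.
have cE v : c v = \sum_(p < s) a p v + \sum_(q < t) b q v.
  by rewrite ffun_addE !sum_ffunE.
have ca p := (proj1 (basic_coverP _ (ltn0Sn 0) xy)) (abas p).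
have cb q := (proj1 (basic_coverP _ (ltn0Sn 1) xy)) (bbas q).
have kE : s + 2 * t = \sum_(p < s) 1 + \sum_(q < t) 2.
  by rewrite !sum_nat_const !card_ord; lia.
have cEE u v : c u + c v = 
    \sum_(p < s) (a p u + a p v) + \sum_(q < t) (b q u + b q v).
  by rewrite !cE !big_split addnACA.
apply: (tight_basic_cover _ xy sqG); first by lia.
- move=> i j ij; rewrite kE cEE; apply: leq_add; apply: leq_sum => p _.
    by have [+ _] := ca p; apply.
  by have [+ _] := cb p; apply.
- move=> i j sq; rewrite kE cEE; congr (_ + _); apply: eq_bigr => p _.
    exact: square_edge_tight (abas p) sq.
  exact: square_edge_tight (bbas p) sq.
move=> i; rewrite cE addn_gt0 !lt0n !sum_nat_eq0 => /orP[]/forallPn[p];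
  rewrite -lt0n => ?.
  by have [_ /(_ i)[//|v iv _]] := ca p; exists v.
by have [_ /(_ i)[//|v iv _]] := cb p; exists v.
Qed.

Lemma MSC_square_matchable n (G : graph n) : MSC G -> square_matchable G.
Proof.
case=> _ [M [[/subsetP Me Mp] Msq]] i v iv.
have /bigcupP[B BM iB] : i \in cover M.
  by rewrite (cover_partition Mp) inE; apply/existsP; exists v.
have /imset2P[x y _ + Bxy] := Me _ BM; rewrite !inE => xy.
rewrite {B}Bxy !inE in BM iB.
case/orP: iB => /eqP-> ; [exists y | exists x; apply: square_edge_sym];
  split=> //; exact: Msq.
Qed.

Lemma MSC_edge n (G : graph n) : MSC G -> exists i j, G i j.
Proof.
by case=> /set0Pn[i]; rewrite inE => /existsP[j ij] _; exists i, j.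
Qed.

Lemma MSC_domain n (G : graph n) : MSC G -> graph_domain G.
Proof.
move=> mscG s t st a b; have [x [y xy]] := MSC_edge mscG.
exact: basic_cover_sum xy (MSC_square_matchable mscG) st.
Qed.

(** Tightness of the edges of M means that the ones pick exactly one vertex from
    each of them. *)
Lemma basic_ones_card n (G : graph n) M (a : {ffun 'I_n -> nat}) x y :
  G x y -> red_perfect_matching G M ->
  (forall i j, [set i; j] \in M -> square_edge G i j) ->
  basic_cover G 1 a -> #|[set i | a i == 1]| = #|M|.
Proof.
move=> xy [/subsetP Me Mp] Msq abas.
apply: (@card_transversal _ _ _ (red_vertices G)); apply/and3P; split=> //.
  apply/subsetP => i; rewrite !inE => /eqP ai; apply/existsP.
  have [_ /(_ i)[|j ij _]] := (proj1 (basic_coverP _ (ltn0Sn 0) xy)) abas.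
    by rewrite ai.
  by exists j.
apply/forall_inP => B BM.
have /imset2P[u v _ _ Buv] := Me _ BM; rewrite {B}Buv in BM *.
have uvE := square_edge_tight (ltn0Sn 0) abas (Msq _ _ BM).
have [au|au] := posnP (a u).
  apply/cards1P; exists v; apply/setP => w; rewrite !inE.
  have [->|wv] := eqVneq w v; first by rewrite orbT andbT; apply/eqP; lia.
  by have [->|] := eqVneq w u; rewrite ?au // andbF.
apply/cards1P; exists u; apply/setP => w; rewrite !inE.
have [->|wv] := eqVneq w u; first by rewrite andbT; apply/eqP; lia.
by have [->|] := eqVneq w v; rewrite ?andbF // andbT; apply/eqP; lia.
Qed.

Lemma MSC_unmixed n (G : graph n) : MSC G -> unmixed G.
Proof.
move=> mscG a b abas bbas; have [x [y xy]] := MSC_edge mscG.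
case: mscG => _ [M [Mp Msq]].
have Msq' i j : [set i; j] \in M -> square_edge G i j.
  move=> ijM; split; last exact: Msq.
  have [/subsetP/(_ _ ijM)/imset2P[u v _ + ijE] _] := Mp.
  rewrite !inE => uv.
  have : (u \in [set i; j]) && (v \in [set i; j]).
    by rewrite ijE !inE !eqxx orbT.
  rewrite !inE => /andP[/orP[]/eqP ui /orP[]/eqP vi]; move: uv;
    by rewrite ui vi ?edge_irr // edge_sym.
by rewrite (basic_ones_card xy Mp Msq' abas) (basic_ones_card xy Mp Msq' bbas).
Qed.

(** * A domain has a square edge at every non-isolated vertex *)

(** Without edges the unit vectors are the basic k-covers for every k, and the
    sum of two of them is not one. *)
Lemma domain_edge n (G : graph n) :
  0 < n -> graph_domain G -> exists x y, G x y.
Proof.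
move=> n0 domG; pose o := Ordinal n0.
suff /existsP[x /existsP[y xy]] : [exists x, exists y, G x y] by exists x, y.
apply: contraPT domG => /existsPn noG domG.
have cov k a : a <> 0%R -> kcover G k a.
  by move=> a0; split=> // i j ij; have /existsPn/(_ j) := noG i; rewrite ij.
have obas : basic_cover G 1 (unit_vec o).
  split; first by apply: cov; apply: unit_vec_neq0.
  case=> b [c [[/ffun_nat_neq0P[i bi] _] [/ffun_nat_neq0P[j cj] _] /ffunP e]].
  have := e i; have := e j; rewrite !ffun_addE !ffunE.
  have [ej|_] := eqVneq j o; last by lia.
  have [ei|_] := eqVneq i o; last by lia.
  by subst i j; lia.
have st : ~ (2 = 0 /\ 0 = 0) by case.
have [] := domG 2 0 st (fun=> unit_vec o) (fun=> 0%R) (fun=> obas).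
  by case.
move=> _; apply; exists (unit_vec o), (unit_vec o).
split; [by apply: cov; apply: unit_vec_neq0 .. | ].
by rewrite big_ord0 !big_ord_recr big_ord0 /= GRing.add0r GRing.addr0.
Qed.

Lemma zero_pair_cover n (G : graph n) i' j' : ~~ G i' j' ->
  covers G 2 [ffun v => if (v == i') || (v == j') then 0 else 2].
Proof.
move=> nij u v uv; rewrite !ffunE.
case: ifP => // /orP[]/eqP eu; case: ifP => // /orP[]/eqP ev; move: uv nij;
  by rewrite eu ev ?edge_irr // 1?edge_sym => ->.
Qed.

(** If no edge at i is square, a sum of basic 2-covers is tight at no edge of i.
    The values 0 and 2 let the construction include the case i' = j', where
    {i, j} is an edge of a triangle. *)
Lemma domain_square_matchable n (G : graph n) :
  graph_domain G -> square_matchable G.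
Proof.
move=> domG i x ix.
suff /existsP[j /square_edgeP sqij] : [exists j, square_edgeb G i j].
  by exists j.
apply: contraPT domG => /existsPn nsq domG.
(* At non-neighbours of i any basic 2-cover will do: the family is indexed by
   all the vertices. *)
have slack j : exists b : {ffun 'I_n -> nat},
    basic_cover G 2 b /\ (G i j -> 0 < b i /\ 2 < b i + b j).
  have [ij|nij] := boolP (G i j); last first.
    have cov2 : covers G 2 [ffun=> 2] by move=> u v _; rewrite !ffunE.
    by have [b bbas _] := basic_cover_below (ltn0Sn 1) ix cov2; exists b.
  have := nsq j; rewrite /square_edgeb ij => /forallPn[i' /forallPn[j']].
  rewrite !negb_imply => /and3P[ii' jj' nij'].
  have [b bbas b_le] := basic_cover_below (ltn0Sn 1) ix (zero_pair_cover nij').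
  have bi' : b i' = 0 by have := b_le i'; rewrite ffunE eqxx leqn0 => /eqP.
  have bj' : b j' = 0 by have := b_le j'; rewrite ffunE eqxx orbT leqn0 => /eqP.
  have [bcov _] := (proj1 (basic_coverP _ (ltn0Sn 1) ix)) bbas.
  by exists b; split=> // _; have := bcov _ _ ii'; have := bcov _ _ jj'; lia.
have [b /all_and2[bbas bslack]] := fin_all_exists slack.
have n0 : 0 < n by apply: leq_ltn_trans (ltn_ord i).
have st : ~ (0 = 0 /\ n = 0) by case; lia.
have k0 : 0 < 0 + 2 * n by lia.
have sbas : basic_cover G (0 + 2 * n) (\sum_(q < n) b q)%R.
  have := domG 0 n st (fun=> 0%R) b _ bbas; rewrite big_ord0 GRing.add0r; apply.
  by case.
have [_ tight] := (proj1 (basic_coverP _ k0 ix)) sbas.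
have [|j ij] := tight i.
  rewrite sum_ffunE (bigD1 x) //=.
  by have [bx _] := bslack _ ix; apply: leq_trans bx (leq_addr _ _).
rewrite !sum_ffunE -big_split /= => sumE.
have [_ bj] := bslack _ ij.
have le2 q : 2 <= b q i + b q j.
  by have [+ _] := (proj1 (basic_coverP _ (ltn0Sn 1) ix)) (bbas q); apply.
have : \sum_(q < n) 2 < \sum_(q < n) (b q i + b q j).
  rewrite (bigD1 j) //= [X in _ < X](bigD1 j) //= -addSn.
  by apply: leq_add => //; apply: leq_sum.
by rewrite sum_nat_const card_ord sumE; lia.
Qed.

(** * Unmixedness balances the twin classes *)

Definition twins n (G : graph n) (i : 'I_n) : {set 'I_n} :=
  [set v | [forall w, G v w == G i w]].

Lemma twinsP n (G : graph n) i v : reflect (G v =1 G i) (v \in twins G i).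
Proof. by rewrite inE; apply: (iffP forallP) => e w; apply/eqP; apply: e. Qed.

Lemma twins_refl n (G : graph n) i : i \in twins G i.
Proof. exact/twinsP. Qed.

Lemma twins_eq n (G : graph n) i j : i \in twins G j -> twins G i = twins G j.
Proof.
by move/twinsP=> e; apply/setP => v; apply/twinsP/twinsP => f w; rewrite f e.
Qed.

(** Two square edges joined by two disjoint edges span a complete bipartite
    part; this is what separates the different pairs of twin classes. *)
Lemma square_cross_twins n (G : graph n) i j p q :
  square_edge G i j -> square_edge G p q -> G i p -> G j q -> q \in twins G i.
Proof.
move=> [_ sqij] [_ sqpq] ip jq; apply/twinsP => w; apply/idP/idP => [qw|iw].
  by apply: sqpq qw; rewrite edge_sym.
by rewrite edge_sym; apply: sqij.
Qed.

Lemma square_edge_twins n (G : graph n) i j :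
  square_edge G i j -> forall v, square_edge G i v <-> v \in twins G j.
Proof.
move=> sqij v; have [ij sq] := sqij; split=> [sqiv|/twinsP e].
  have [iv _] := sqiv.
  apply: (square_cross_twins (square_edge_sym sqij) sqiv) => //.
  by rewrite edge_sym.
split=> [|i' v' ii']; last by rewrite e; apply: sq.
by rewrite edge_sym e edge_sym.
Qed.

Lemma twins_disjoint n (G : graph n) i j v :
  G i j -> v \in twins G i -> v \notin twins G j.
Proof.
move=> ij /twinsP vi; apply/negP => /twinsP vj.
by have := vj j; rewrite vi ij edge_irr.
Qed.

(** For a vanishing on the twins of i and equal to 1 on those of j, this
    exchanges the two values. *)
Definition swap_cover n (G : graph n) i j (a : {ffun 'I_n -> nat}) :
    {ffun 'I_n -> nat} :=
  [ffun v => if v \in twins G i then 1 else if v \in twins G j then 0 else a v].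

Lemma square_twins_iff n (G : graph n) i j u v : 
  square_edge G i j -> square_edge G u v ->
  (u \in twins G i) = (v \in twins G j).
Proof.
move=> sqij squv; apply/idP/idP => [ui|vj].
  apply/(square_edge_twins sqij); apply: square_edge_sym.
  apply/(square_edge_twins (square_edge_sym squv)).
  by rewrite (twins_eq ui) twins_refl.
apply/(square_edge_twins (square_edge_sym sqij)); apply: square_edge_sym.
apply/(square_edge_twins squv).
by rewrite (twins_eq vj) twins_refl.
Qed.

(** The twins of j may drop to 0 because all their neighbours, other than the
    twins of i, have value 1; square edges stay tight because they join the two
    classes or avoid both. *)
Lemma swap_coverP n (G : graph n) i j a :
  square_matchable G -> square_edge G i j -> basic_cover G 1 a ->
  (forall v, G i v || G j v ->
     v \notin twins G i -> v \notin twins G j -> a v = 1) ->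
  basic_cover G 1 (swap_cover G i j a).
Proof.
move=> sqG sqij abas aN; have [ij _] := sqij.
have [acov atight] := (proj1 (basic_coverP _ (ltn0Sn 0) ij)) abas.
apply: (tight_basic_cover _ ij sqG) => //.
- have key v w : G v w -> v \in twins G j -> 0 < swap_cover G i j a w.
    move=> vw /twinsP vj; rewrite ffunE; case: ifPn => // wi.
    case: ifPn => [/twinsP wj|wj].
      by have := wj w; rewrite -vj edge_irr vw.
    by rewrite aN // -vj vw orbT.
  move=> v w vw.
  have [vj|vj] := boolP (v \in twins G j).
    by have := key _ _ vw vj; lia.
  have [wj|wj] := boolP (w \in twins G j).
    by rewrite edge_sym in vw; have := key _ _ vw wj; lia.
  rewrite !ffunE (negbTE vj) (negbTE wj).
  by case: ifP => _; case: ifP => _; rewrite ?addn1 //; apply: acov.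
- move=> u v squv; rewrite !ffunE.
  have e1 := square_twins_iff sqij squv.
  have e2 := square_twins_iff (square_edge_sym sqij) squv.
  rewrite -e1 -e2; have := square_edge_tight (ltn0Sn 0) abas squv.
  have [ui|_] := boolP (u \in twins G i); last by case: ifP.
  by rewrite (negbTE (twins_disjoint ij ui)).
move=> v; rewrite ffunE; case: ifP => [/twinsP vi _|_].
  by exists j; rewrite vi.
by case: ifP => // _ /atight[w vw _]; exists w.
Qed.

(** Let X be the union of the neighbourhoods of i and j.  Apart from the twins
    of i and j, a square edge has at most one end in X ([square_cross_twins]).
    The other ends of such edges form a set I0 which, with i, is independent:
    a neighbour of a vertex in I0 is adjacent to i or to j.  So the vector
    vanishing on I0 and i and equal to 1 elsewhere is a 1-cover, and below it
    the other vertices of X are kept at 1 by their square partners in I0. *)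
Lemma twins_seed n (G : graph n) i j :
  square_matchable G -> square_edge G i j ->
  exists a, [/\ basic_cover G 1 a, a i = 0 &
    forall v, G i v || G j v ->
      v \notin twins G i -> v \notin twins G j -> a v = 1].
Proof.
move=> sqG sqij; have [ij _] := sqij.
pose X := [pred v | G i v || G j v].
pose I0 := [pred v | ~~ X v & [exists p, X p && square_edgeb G v p]].
pose c := [ffun v => nat_of_bool ((v != i) && ~~ I0 v)].
have I0N u v : G u v -> I0 u -> v != i -> ~~ I0 v.
  move=> uv /andP[_ /existsP[p /andP[Xp /square_edgeP[_ sq]]]] vi.
  rewrite inE negb_and negbK; apply/orP; left.
  by case/orP: Xp => xp; apply/orP; [left | right]; rewrite edge_sym;
     apply: (sq v _ uv); rewrite edge_sym.
have iI0 v : G i v -> ~~ I0 v by move=> iv; rewrite inE /= iv.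
have ccov : covers G 1 c.
  move=> u v uv; rewrite !ffunE; have [ui|ui] := eqVneq u i.
    rewrite ui in uv; rewrite (iI0 _ uv) andbT.
    have [vi|] := eqVneq v i; rewrite ?addn1 // in uv *.
    by rewrite vi edge_irr in uv.
  have [vi|vi] := eqVneq v i.
    by rewrite vi edge_sym in uv; rewrite (iI0 _ uv).
  by case: (boolP (I0 u)) => //= /(I0N _ _ uv)/(_ vi) ->.
have [a abas a_le] := basic_cover_below (ltn0Sn 0) ij ccov.
exists a; split=> // [|w Xw wi wj].
  by have := a_le i; rewrite ffunE eqxx leqn0 => /eqP.
have [u sqwu] : exists u, square_edge G w u.
  by case/orP: (Xw) => xw; rewrite edge_sym in xw; apply: sqG xw.
have sqji := square_edge_sym sqij; have squw := square_edge_sym sqwu.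
have XuN : ~~ X u.
  apply/negP => /orP[]xu; case/orP: Xw => xw.
  - exact: square_no_triangle sqwu xw xu.
  - by rewrite (square_cross_twins sqij squw xu xw) in wi.
  - by rewrite (square_cross_twins sqji squw xu xw) in wj.
  - exact: square_no_triangle sqwu xw xu.
have au : a u = 0.
  apply/eqP; rewrite -leqn0; apply: leq_trans (a_le u) _.
  rewrite ffunE inE /= XuN.
  have -> : [exists p, X p && square_edgeb G u p].
    by apply/existsP; exists w; apply/andP; split=> //; apply/square_edgeP.
  by rewrite andbF.
by have := square_edge_tight (ltn0Sn 0) abas sqwu; rewrite au addn0.
Qed.

(** The exchange of the two classes changes the number of ones by the difference
    of their cardinalities. *)
Lemma unmixed_card_twins n (G : graph n) i j :
  unmixed G -> square_matchable G -> square_edge G i j ->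
  #|twins G i| = #|twins G j|.
Proof.
move=> unG sqG sqij; have [ij _] := sqij.
have [a [abas ai aN]] := twins_seed sqG sqij.
have tight := square_edge_tight (ltn0Sn 0) abas.
have aj v : v \in twins G j -> a v = 1.
  by move/(square_edge_twins sqij)/tight; rewrite ai.
have ai0 v : v \in twins G i -> a v = 0.
  move/(square_edge_twins (square_edge_sym sqij))/tight.
  by rewrite aj ?twins_refl //; lia.
have := unG _ _ abas (swap_coverP sqG sqij abas aN).
set A := [set v | a v == 1]; set B := [set v | _ == 1] => AB.
have memA v : (v \in A) = (a v == 1) by rewrite inE.
have memB v : (v \in B) = (swap_cover G i j a v == 1) by rewrite inE.
have Aj : A :&: twins G j = twins G j.
  by apply/setIidPr/subsetP => v /aj; rewrite memA => ->.
have Bi : B :&: twins G i = twins G i.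
  by apply/setIidPr/subsetP => v vi; rewrite memB ffunE vi.
have ABD : A :\: twins G j = B :\: twins G i.
  apply/setP => v; rewrite !in_setD memA memB ffunE.
  have [vi|vi] := boolP (v \in twins G i); first by rewrite ai0 // andbF.
  by case: ifP.
have := cardsID (twins G j) A; have := cardsID (twins G i) B.
by rewrite Aj Bi ABD AB => <- /addIn.
Qed.

(** * Matching the twin classes *)

(** Paired twin classes are matched in the order of their enumerations.  The
    vertex j only serves to name the class opposite to i, which is the same for
    every choice made by [pick]; i itself is the default for vertices on no
    square edge. *)
Definition mate n (G : graph n) (i : 'I_n) : 'I_n :=
  let j := odflt i [pick j | square_edgeb G i j] in
  nth i (enum (twins G j)) (index i (enum (twins G i))).

(** The mate of the mate is i again because both vertices have the same index
    in their classes. *)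
Lemma mateP n (G : graph n) i j :
  (forall i j, square_edge G i j -> #|twins G i| = #|twins G j|) ->
  square_edge G i j -> square_edge G i (mate G i) /\ mate G (mate G i) = i.
Proof.
move=> twinsE.
have mateE u v : square_edge G u v ->
    mate G u = nth u (enum (twins G v)) (index u (enum (twins G u))).
  move=> squv; rewrite /mate; case: pickP => [w /square_edgeP squw|/(_ v)].
    by rewrite /= (twins_eq (proj1 (square_edge_twins squv _) squw)).
  by move/square_edgeP.
have lt_index u v : square_edge G u v ->
    index u (enum (twins G u)) < size (enum (twins G v)).
  by move/twinsE; rewrite !cardE => <-; rewrite index_mem mem_enum twins_refl.
move=> sqij.
have mj : mate G i \in twins G j.
  by rewrite (mateE _ _ sqij) -mem_enum mem_nth // lt_index.
have sqm := proj2 (square_edge_twins sqij _) mj.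
split=> //; rewrite (mateE _ i) ?(twins_eq mj); last exact: square_edge_sym.
rewrite [in index _ _](mateE _ _ sqij) index_uniq ?enum_uniq ?lt_index //.
by rewrite nth_index // mem_enum twins_refl.
Qed.

Lemma square_matchable_MSC n (G : graph n) x y :
  G x y -> square_matchable G ->
  (forall i j, square_edge G i j -> #|twins G i| = #|twins G j|) -> MSC G.
Proof.
move=> xy sqG twinsE.
have redP i : reflect (exists v, G i v) (i \in red_vertices G).
  by rewrite inE; apply: existsP.
have mateR i : i \in red_vertices G ->
    square_edge G i (mate G i) /\ mate G (mate G i) = i.
  by move/redP=> [v /sqG[j]]; apply: mateP twinsE.
split; first by apply/set0Pn; exists x; apply/redP; exists y.
pose M := [set [set i; mate G i] | i in red_vertices G].
have blockE i v : i \in red_vertices G -> v \in [set i; mate G i] ->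
    [set i; mate G i] = [set v; mate G v].
  move=> iR; rewrite !inE => /orP[]/eqP-> //.
  by have [_ ->] := mateR _ iR; rewrite setUC.
have MP B : reflect (exists2 i, i \in red_vertices G & B = [set i; mate G i])
    (B \in M) by exact: imsetP.
exists M; split; last first.
  move=> i j /MP[u uR ijE].
  have [squ uK] := mateR _ uR; have [uu' _] := squ.
  have uni : u != mate G u by apply: contraTneq uu' => <-; rewrite edge_irr.
  have iB : i \in [set u; mate G u] by rewrite -ijE !inE eqxx.
  have ji : j != i.
    apply/eqP => ji; have := cards2 u (mate G u).
    by rewrite -ijE ji setUid cards1 uni.
  have iR : i \in red_vertices G.
    move: iB; rewrite !inE => /orP[]/eqP->; apply/existsP.
      by exists (mate G u).
    by exists u; rewrite edge_sym.
  have : j \in [set i; mate G i].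
    by rewrite -(blockE _ _ uR iB) -ijE !inE eqxx orbT.
  rewrite !inE (negbTE ji) /= => /eqP->.
  by have [[_ sq] _] := mateR _ iR.
split.
  apply/subsetP => B /MP[i iR ->]; have [[ij _] _] := mateR _ iR.
  by apply/imset2P; exists i (mate G i); rewrite ?inE.
apply/and3P; split.
- apply/eqP/setP => v; apply/bigcupP/idP => [[B /MP[i iR ->]]|vR].
    have [[ij _] _] := mateR _ iR.
    rewrite in_set2 => /orP[]/eqP-> //.
    by apply/redP; exists i; rewrite edge_sym.
  by exists [set v; mate G v]; [apply/MP; exists v | rewrite !inE eqxx].
- apply/trivIsetP => A B /MP[i iR ->] /MP[j jR ->]; apply: contraNT.
  rewrite -setI_eq0 => /set0Pn[v]; rewrite inE => /andP[vi vj].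
  by rewrite (blockE _ _ iR vi) (blockE _ _ jR vj).
apply/negP => /MP[i _ /setP/(_ i)].
by rewrite !inE eqxx.
Qed.

Theorem theorem2 (n : nat) (hn : 0 < n) (G : graph n) :
  MSC G <-> unmixed G /\ graph_domain G.
Proof.
split=> [mscG|[unG domG]].
  by split; [apply: MSC_unmixed | apply: MSC_domain].
have [x [y xy]] := domain_edge hn domG.
have sqG := domain_square_matchable domG.
apply: (square_matchable_MSC xy sqG) => i j.
exact: unmixed_card_twins unG sqG.
Qed.
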